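(* Let $S$ be the antipode of the Hopf algebra $(\mathcal{H}_{\mathbf{G}},m,\Delta)$ of graphs. For every graph $G\in\mathbf{G}$, $$S(G)=\sum_{H\in \mathcal{PO}_{tac}(G)} (-1)^{\mathrm{cc}(\mathrm{gr}_0(H))}\, \mathrm{gr}_0(H),$$ where $\mathcal{PO}_{tac}(G)$ is the set of totally acyclic partial orientations of $G$ and, for any graph $K$, $\mathrm{cc}(K)$ is the number of connected components of $K$.
   Context: $\mathbb{K}$ is a commutative field of characteristic $0$. Graphs are finite and simple: $G=(V(G),E(G))$ with $E(G)$ a set of unordered pairs of distinct vertices; the empty graph is allowed. $\mathbf{G}$ is the set of isoclasses of graphs and $\mathcal{H}_{\mathbf{G}}$ is the $\mathbb{K}$-vector space with basis $\mathbf{G}$. The product $m$ is the disjoint union of graphs (unit: the empty graph $1$). For $I\subseteq V(G)$, $G_{\mid I}$ is the subgraph induced by $I$. The coproduct is $\Delta(G)=\sum_{I\subseteq V(G)} G_{\mid I}\otimes G_{\mid V(G)\setminus I}$, with counit $\varepsilon_\Delta(G)=1$ if $G$ is empty and $0$ otherwise. $(\mathcal{H}_{\mathbf{G}},m,\Delta)$ is a Hopf algebra. A mixed graph is a triple $H=(V(H),E(H),A(H))$ with $V(H)$ a finite set, $E(H)$ a set of unordered pairs of distinct elements of $V(H)$ (edges), and $A(H)$ a set of ordered pairs of distinct elements of $V(H)$ (arcs), such that for all distinct $x,y\in V(H)$ at most one of $\{x,y\}\in E(H)$, $(x,y)\in A(H)$, $(y,x)\in A(H)$ holds. The simple graphs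 $\mathrm{gr}(H)$ and $\mathrm{gr}_0(H)$ both have vertex set $V(H)$, with $E(\mathrm{gr}(H))=E(H)\cup\{\{x,y\}\mid (x,y)\in A(H)\}$ and $E(\mathrm{gr}_0(H))=E(H)$. A partial orientation of a graph $G$ is a mixed graph $H$ with $\mathrm{gr}(H)=G$ (same vertex set, as labelled objects). It is not totally acyclic if there is a sequence $(x_0,\ldots,x_n)$ of vertices with $n\ge 2$, $x_0=x_n$, such that for every $i\in\{1,\ldots,n\}$, $\{x_{i-1},x_i\}\in E(H)$ or $(x_{i-1},x_i)\in A(H)$, and there is at least one $i$ with $(x_{i-1},x_i)\in A(H)$; otherwise it is totally acyclic. *)

(* Defs.v *)
From HB Require Import structures.
From mathcomp Require Import all_boot all_algebra.
From mathcomp Require Import generic_quotient finmap.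
From mathcomp.multinomials Require Import monalg.

Set Implicit Arguments.
Unset Strict Implicit.
Unset Printing Implicit Defensive.

Import GRing.Theory.
Local Open Scope ring_scope.
Local Open Scope quotient_scope.

Record sgraph (T : finType) := SGraph {
  edges : {set {set T}};
  edges_axiom : [forall e in edges, #|e| == 2]
}.

HB.instance Definition _ (T : finType) := [isSub for @edges T].
HB.instance Definition _ (T : finType) := [Finite of sgraph T by <:].

Definition adj (T : finType) (G : sgraph T) : rel T :=
  fun x y => [set x; y] \in edges G.

Definition cc (T : finType) (G : sgraph T) : nat := n_comp (adj G) T.

Lemma card_edge (T : finType) (G : sgraph T) e : e \in edges G -> #|e| = 2.
Proof. by move=> eG; apply/eqP; exact: (forall_inP (edges_axiom G)). Qed.

Section Pullback.
Variables (T T' : finType) (f : T' -> T) (f_inj : injective f).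
Variable G : sgraph T.

Fact pullback_axiom :
  [forall e in [set e : {set T'} | f @: e \in edges G], #|e| == 2].
Proof.
apply/forall_inP => e; rewrite inE => /card_edge <-.
by rewrite card_imset.
Qed.

Definition pullback : sgraph T' := SGraph pullback_axiom.
End Pullback.

Definition induced (T : finType) (G : sgraph T) (I : {set T}) :
  sgraph {x : T | x \in I} := pullback val_inj G.

Section DisjointUnion.
Variables (T T' : finType) (G : sgraph T) (G' : sgraph T').

Definition dunion_edges : {set {set T + T'}} :=
  [set inl @: (e : {set T}) | e in edges G] :|:
  [set inr @: (e : {set T'}) | e in edges G'].

Fact dunion_axiom : [forall e in dunion_edges, #|e| == 2].
Proof.
apply/forall_inP => e; rewrite inE => /orP[] /imsetP[e' /card_edge e'2 ->].
- by rewrite card_imset ?e'2 // => x y [].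
- by rewrite card_imset ?e'2 // => x y [].
Qed.

Definition dunion : sgraph (T + T')%type := SGraph dunion_axiom.
End DisjointUnion.

Fact void_graph_axiom : [forall e in (set0 : {set {set void}}), #|e| == 2].
Proof. by apply/forall_inP => e; rewrite inE. Qed.

Definition void_graph : sgraph void := SGraph void_graph_axiom.

Definition isomorphic (T T' : finType) (G : sgraph T) (G' : sgraph T') :=
  exists2 f : T -> T', bijective f &
    forall e : {set T}, (f @: e \in edges G') = (e \in edges G).

Definition isob (T T' : finType) (G : sgraph T) (G' : sgraph T') : bool :=
  [exists f : {ffun T -> T'},
     [&& injectiveb f, #|T'| <= #|T| &
       [forall e : {set T}, (f @: e \in edges G') == (e \in edges G)]]]%N.

Lemma isobP (T T' : finType) (G : sgraph T) (G' : sgraph T') :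
  reflect (isomorphic G G') (isob G G').
Proof.
apply: (iffP existsP) => [[f /and3P[/injectiveP f_inj le /forallP fE]]|].
  by exists f => [|e]; [exact: inj_card_bij | exact/eqP].
case=> f f_bij fE; exists (finfun f).
have Ef : finfun f =1 f by move=> x; rewrite ffunE.
rewrite (bij_eq_card f_bij) leqnn /=; apply/andP; split.
  by apply/injectiveP => x y; rewrite !Ef; exact: bij_inj.
by apply/forallP => e; rewrite (eq_imset _ Ef) fE.
Qed.

Lemma isomorphic_refl (T : finType) (G : sgraph T) : isomorphic G G.
Proof. by exists id => [|e]; [exists id | rewrite imset_id]. Qed.

Lemma isomorphic_sym (T T' : finType) (G : sgraph T) (G' : sgraph T') :
  isomorphic G G' -> isomorphic G' G.
Proof.
case=> f [g fK gK] fE; exists g => [|e]; first by exists f.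
by rewrite -fE -imset_comp (eq_imset _ gK) imset_id.
Qed.

Lemma isomorphic_trans (T1 T2 T3 : finType) (G1 : sgraph T1) (G2 : sgraph T2)
    (G3 : sgraph T3) :
  isomorphic G1 G2 -> isomorphic G2 G3 -> isomorphic G1 G3.
Proof.
case=> f f_bij fE [g g_bij gE]; exists (g \o f) => [|e]; first exact: bij_comp.
by rewrite imset_comp gE fE.
Qed.

Definition lgraph := {n : nat & sgraph 'I_n}.
HB.instance Definition _ := Choice.on lgraph.

Definition lgraph_iso : rel lgraph := fun G G' => isob (tagged G) (tagged G').

Fact lgraph_iso_refl : reflexive lgraph_iso.
Proof. by move=> G; apply/isobP/isomorphic_refl. Qed.

Fact lgraph_iso_sym : symmetric lgraph_iso.
Proof. by move=> G G'; apply/isobP/isobP; exact: isomorphic_sym. Qed.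

Fact lgraph_iso_trans : transitive lgraph_iso.
Proof.
by move=> G2 G1 G3 /isobP G12 /isobP G23; apply/isobP/isomorphic_trans/G23.
Qed.

Canonical lgraph_iso_equiv :=
  EquivRel lgraph_iso lgraph_iso_refl lgraph_iso_sym lgraph_iso_trans.

Definition isograph := {eq_quot lgraph_iso}.
HB.instance Definition _ := Choice.on isograph.

HB.lock Definition isoclass (T : finType) (G : sgraph T) : isograph :=
  \pi_{eq_quot lgraph_iso}
    (Tagged (fun n => sgraph 'I_n) (pullback (@enum_val_inj T T) G) : lgraph).
Canonical isoclass_unlockable := Unlockable isoclass.unlock.

Definition reprg (c : isograph) : sgraph 'I_(tag (repr c)) := tagged (repr c).

Lemma isomorphic_pullback (T T' : finType) (f : T' -> T) (f_inj : injective f)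
  (G : sgraph T) : bijective f -> isomorphic (pullback f_inj G) G.
Proof. by move=> f_bij; exists f => // e; rewrite inE. Qed.

Lemma isoclassP (T T' : finType) (G : sgraph T) (G' : sgraph T') :
  isoclass G = isoclass G' <-> isomorphic G G'.
Proof.
have isoE (U : finType) (H : sgraph U) :
    isomorphic (pullback (@enum_val_inj U U) H) H.
  by apply: isomorphic_pullback; exact: enum_val_bij.
rewrite isoclass.unlock; split=> [/eqmodP /isobP /= h | h].
  apply: isomorphic_trans (isomorphic_sym (isoE _ G)) _.
  exact: isomorphic_trans h (isoE _ G').
apply/eqmodP/isobP => /=; apply: isomorphic_trans (isoE _ G) _.
by apply: isomorphic_trans h _; exact/isomorphic_sym/isoE.
Qed.

Lemma reprgK (c : isograph) : isoclass (reprg c) = c.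
Proof.
rewrite -[RHS]reprK isoclass.unlock /reprg; apply/eqmodP/isobP => /=.
by apply: isomorphic_pullback; exact: enum_val_bij.
Qed.

Lemma isoclass_ind (P : isograph -> Prop) :
  (forall (T : finType) (G : sgraph T), P (isoclass G)) -> forall c, P c.
Proof. by move=> h c; rewrite -(reprgK c). Qed.

Definition isomul (c d : isograph) : isograph :=
  isoclass (dunion (reprg c) (reprg d)).

Definition isoone : isograph := isoclass void_graph.

Lemma adj_sym (T : finType) (G : sgraph T) : symmetric (adj G).
Proof. by move=> x y; rewrite /adj setUC. Qed.

Lemma adj_neq (T : finType) (G : sgraph T) x y : adj G x y -> x != y.
Proof. by move=> /card_edge; rewrite cards2; case: eqP. Qed.

Definition adj_sum (T T' : finType) (G : sgraph T) (G' : sgraph T') :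
    rel (T + T') := fun u v =>
  match u, v with
  | inl x, inl y => adj G x y
  | inr x, inr y => adj G' x y
  | _, _ => false
  end.

Lemma adj_dunion (T T' : finType) (G : sgraph T) (G' : sgraph T') :
  adj (dunion G G') =2 adj_sum G G'.
Proof.
have inl_inr x (e : {set T'}) : (inl x : T + T')%type \notin inr @: e.
  by apply/imsetP => -[].
have inr_inl x (e : {set T}) : (inr x : T + T')%type \notin inl @: e.
  by apply/imsetP => -[].
have inlI : injective (@inl T T') by move=> x y [].
have inrI : injective (@inr T T') by move=> x y [].
have Nl (e : {set T + T'}) x :
    inr x \in e -> e \notin [set inl @: (a : {set T}) | a in edges G].
  by move=> xe; apply/imsetP => -[a _ ea]; move: xe; rewrite ea (negPf (inr_inl _ _)).
have Nr (e : {set T + T'}) x :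
    inl x \in e -> e \notin [set inr @: (a : {set T'}) | a in edges G'].
  by move=> xe; apply/imsetP => -[a _ ea]; move: xe; rewrite ea (negPf (inl_inr _ _)).
case=> u [] v; rewrite /adj /= inE.
- rewrite (negPf (Nr _ u _)) ?set21 // orbF -(imset_set1 inl v) -imsetU1.
  by rewrite (mem_imset _ _ (imset_inj inlI)).
- by rewrite (negPf (Nl _ v _)) ?(negPf (Nr _ u _)) // ?set21 ?set22.
- by rewrite (negPf (Nl _ u _)) ?(negPf (Nr _ v _)) // ?set21 ?set22.
- rewrite (negPf (Nl _ u _)) ?set21 //= -(imset_set1 inr v) -imsetU1.
  by rewrite (mem_imset _ _ (imset_inj inrI)).
Qed.

Lemma isomorphic_adjP (T T' : finType) (G : sgraph T) (G' : sgraph T') :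
  isomorphic G G' <->
  exists2 f : T -> T', bijective f & forall x y, adj G' (f x) (f y) = adj G x y.
Proof.
split=> -[f f_bij fE]; exists f => //; [move=> x y|move=> e].
  by rewrite /adj -fE imsetU1 imset_set1.
apply/idP/idP => eG; have := card_edge eG; last first.
  by move/eqP/cards2P => [x [y [_ eE]]]; move: eG;
    rewrite eE imsetU1 imset_set1 => h; rewrite -[_ \in _]/(adj _ _ _) fE.
rewrite card_imset; last exact: bij_inj.
by move/eqP/cards2P => [x [y [_ eE]]]; move: eG;
  rewrite eE imsetU1 imset_set1 -[_ \in _]/(adj _ _ _) fE.
Qed.

Lemma isoclass_dunion (T T' : finType) (G : sgraph T) (G' : sgraph T') :
  isomul (isoclass G) (isoclass G') = isoclass (dunion G G').
Proof.
apply/isoclassP/isomorphic_adjP.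
have /isoclassP/isomorphic_adjP[f [f1 fK f1K] fE] := reprgK (isoclass G).
have /isoclassP/isomorphic_adjP[g [g1 gK g1K] gE] := reprgK (isoclass G').
exists (fun u => match u with inl x => inl (f x) | inr x => inr (g x) end).
  exists (fun u => match u with inl x => inl (f1 x) | inr x => inr (g1 x) end).
    by case=> x; rewrite ?fK ?gK.
  by case=> x; rewrite ?f1K ?g1K.
by move=> [] x [] y; rewrite !adj_dunion /= ?fE ?gE.
Qed.

Fact isomulC : commutative isomul.
Proof.
move=> c d; elim/isoclass_ind: c => T G; elim/isoclass_ind: d => T' G'.
rewrite !isoclass_dunion; apply/isoclassP/isomorphic_adjP.
exists (fun u => match u with inl x => inr x | inr x => inl x end).
  by exists (fun u => match u with inl x => inr x | inr x => inl x end); case.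
by move=> [] x [] y; rewrite !adj_dunion.
Qed.

Fact isomulA : associative isomul.
Proof.
move=> c1 c2 c3; elim/isoclass_ind: c1 => T1 G1.
elim/isoclass_ind: c2 => T2 G2; elim/isoclass_ind: c3 => T3 G3.
rewrite !isoclass_dunion; apply/isoclassP/isomorphic_adjP.
exists (fun u => match u with
  inl x => inl (inl x) | inr (inl x) => inl (inr x) | inr (inr x) => inr x end).
  exists (fun u => match u with
    inl (inl x) => inl x | inl (inr x) => inr (inl x) | inr x => inr (inr x) end).
    by case=> // -[].
  by case=> // -[].
by move=> [x|[x|x]] [y|[y|y]]; rewrite !adj_dunion /= ?adj_dunion.
Qed.

Fact isomul1c : left_id isoone isomul.
Proof.
elim/isoclass_ind => T G; rewrite isoclass_dunion.
apply/isoclassP/isomorphic_adjP.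
exists (fun u : void + T => match u with inl x => of_void T x | inr x => x end).
  by exists inr => // -[].
by move=> [[]|x] [[]|y]; rewrite adj_dunion.
Qed.

Fact isomulc1 : right_id isoone isomul.
Proof. by move=> c; rewrite isomulC isomul1c. Qed.

Lemma isoclass_eq1 (T : finType) (G : sgraph T) :
  (isoclass G == isoone) = (#|T| == 0)%N.
Proof.
apply/eqP/eqP => [/isoclassP[f /bij_eq_card -> _]|T0]; first by rewrite card_void.
have noT (x : T) : False by have := fintype0 x T0.
apply/isoclassP/isomorphic_adjP.
exists (fun x => False_rect void (noT x)); last by move=> x; case: (noT x).
by exists (of_void T) => x //; case: (noT x).
Qed.

Fact isomul_eq1 c d : isomul c d = isoone -> c = isoone /\ d = isoone.
Proof.
elim/isoclass_ind: c => T G; elim/isoclass_ind: d => T' G'.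
rewrite isoclass_dunion => /eqP; rewrite isoclass_eq1 card_sum addn_eq0.
by rewrite -(isoclass_eq1 G) -(isoclass_eq1 G') => /andP[/eqP-> /eqP->].
Qed.

HB.instance Definition _ := Choice_isMonomialDef.Build isograph
  isomulA isomul1c isomulc1 isomul_eq1.
HB.instance Definition _ := MonomialDef_isConomialDef.Build isograph isomulC.

Notation Hgr K := {malg K[isograph]}.
(* The tensor square of Hgr K, the pure tensor of two basis elements g and h
   being << (g, h) >>. *)
Notation Hgr2 K := {malg K[(isograph * isograph)%type]}.

HB.lock Definition linext (K : fieldType) (B : choiceType) (V : lmodType K)
  (f : B -> V) (x : {malg K[B]}) : V := \sum_(b <- msupp x) x@_b *: f b.
Canonical linext_unlockable := Unlockable linext.unlock.

Section LinearExtension.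
Variables (K : fieldType) (B : choiceType) (V : lmodType K) (f : B -> V).

Local Notation linext := (linext f).

Lemma linextE (x : {malg K[B]}) : linext x = \sum_(b <- msupp x) x@_b *: f b.
Proof. by rewrite unlock. Qed.

Lemma linextEw (d : {fset B}) (x : {malg K[B]}) :
  (msupp x `<=` d)%fset -> linext x = \sum_(b <- d) x@_b *: f b.
Proof.
move=> sxd; rewrite linextE (big_fset_incl _ sxd) // => b _ /mcoeff_outdom ->.
by rewrite scale0r.
Qed.

Fact linext_is_linear : linear linext.
Proof.
move=> a x y; pose d := (msupp x `|` msupp y)%fset.
have sx : (msupp x `<=` d)%fset by exact: fsubsetUl.
have sy : (msupp y `<=` d)%fset by exact: fsubsetUr.
have sxy : (msupp (a *: x + y) `<=` d)%fset.
  apply: fsubset_trans (msuppD_le _ _) _.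
  by rewrite fsubUset sy (fsubset_trans (msuppZ_le _ _) sx).
rewrite !(linextEw (d := d)) // scaler_sumr -big_split /=.
by apply: eq_bigr => b _; rewrite mcoeffD mcoeffZ scalerDl scalerA.
Qed.

HB.instance Definition _ :=
  GRing.isLinear.Build K {malg K[B]} V _ linext linext_is_linear.

Lemma linextU (b : B) : linext << b >> = f b.
Proof.
by rewrite linextE msuppU oner_eq0 big_seq_fset1 mcoeffUU scale1r.
Qed.
End LinearExtension.

Lemma malg_basis (K : fieldType) (B : choiceType) (x : {malg K[B]}) :
  x = \sum_(b <- msupp x) x@_b *: << b >>.
Proof.
rewrite {1}[x]monalgE; apply: eq_bigr => b _.
by apply/malgP => b'; rewrite mcoeffZ !mcoeffU; case: eqP; rewrite ?mulr1 ?mulr0.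
Qed.

Section Hopf.
Variable K : fieldType.

Definition tens (x y : Hgr K) : Hgr2 K :=
  linext (fun c => linext (fun d => (<< (c, d) >> : Hgr2 K)) y) x.

Definition tensmap (f g : Hgr K -> Hgr K) : Hgr2 K -> Hgr2 K :=
  linext (fun cd : isograph * isograph => tens (f << cd.1 >>) (g << cd.2 >>)).

Definition mult : Hgr2 K -> Hgr K :=
  linext (fun cd : isograph * isograph => << cd.1 >> * << cd.2 >> : Hgr K).

Definition coprod_graph (T : finType) (G : sgraph T) : Hgr2 K :=
  \sum_(I : {set T}) << (isoclass (induced G I), isoclass (induced G (~: I))) >>.

Definition coprod : Hgr K -> Hgr2 K := linext (fun c => coprod_graph (reprg c)).

Definition counit : Hgr K -> K :=
  linext (fun c => (c == isoone)%:R : K^o).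

Definition is_antipode (S : {linear Hgr K -> Hgr K}) : Prop :=
  forall x : Hgr K,
    mult (tensmap S id (coprod x)) = counit x *: 1 /\
    mult (tensmap id S (coprod x)) = counit x *: 1.

HB.instance Definition _ f g := GRing.Linear.copy (tensmap f g) (linext _).
HB.instance Definition _ := GRing.Linear.copy mult (linext _).
HB.instance Definition _ := GRing.Linear.copy coprod (linext _).

Lemma coprod_graph_iso (T T' : finType) (G : sgraph T) (G' : sgraph T') :
  isomorphic G G' -> coprod_graph G = coprod_graph G'.
Proof.
move=> /isomorphic_adjP[f [g fK gK] fE].
have f_inj := can_inj fK; have g_inj := can_inj gK.
have indE (I : {set T}) (I' : {set T'}) : (forall x, (f x \in I') = (x \in I)) ->
    isoclass (induced G I) = isoclass (induced G' I').
  move=> II'; apply/isoclassP/isomorphic_adjP.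
  have h1 (x : {x | x \in I}) : f (val x) \in I' by rewrite II' (valP x).
  have h2 (x : {x | x \in I'}) : g (val x) \in I by rewrite -II' gK (valP x).
  exists (fun x => Sub (f (val x)) (h1 x)).
    exists (fun x => Sub (g (val x)) (h2 x)) => x; apply/val_inj => /=.
      by rewrite fK.
    by rewrite gK.
  by move=> x y; rewrite /adj !inE !imsetU1 !imset_set1 -/(adj _ _ _) fE.
rewrite /coprod_graph (reindex (fun I' : {set T'} => f @^-1: I')) /=; last first.
  exists (fun I : {set T} => g @^-1: I) => I _; apply/setP => x; rewrite !inE.
    by rewrite gK.
  by rewrite fK.
apply: eq_bigr => I' _.
by rewrite (indE _ I') 1?(indE _ (~: I')) // => x; rewrite !inE.
Qed.

Lemma coprodE (T : finType) (G : sgraph T) :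
  coprod << isoclass G >> = coprod_graph G.
Proof.
by rewrite /coprod linextU; apply/coprod_graph_iso/isoclassP; rewrite reprgK.
Qed.

Lemma counitE (T : finType) (G : sgraph T) :
  counit << isoclass G >> = (#|T| == 0%N)%:R.
Proof. by rewrite /counit linextU isoclass_eq1. Qed.

Lemma multE (c d : isograph) : mult << (c, d) >> = << mmul c d >>.
Proof. by rewrite /mult linextU /= malgM_def fgmulUU mulr1. Qed.

Lemma mult_tens (x y : Hgr K) : mult (tens x y) = x * y.
Proof.
have multc c : mult (linext (fun d => (<< (c, d) >> : Hgr2 K)) y) = << c >> * y.
  rewrite [in RHS](malg_basis y) mulr_sumr linextE (linear_sum mult).
  apply: eq_bigr => d _.
  by rewrite (linearZ_LR mult) -scalerAr /= /mult linextU.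
rewrite [in RHS](malg_basis x) mulr_suml /tens linextE (linear_sum mult).
by apply: eq_bigr => c _; rewrite (linearZ_LR mult) /= multc scalerAl.
Qed.

Lemma mult_tensmap_coprod (f g : Hgr K -> Hgr K) (T : finType) (G : sgraph T) :
  mult (tensmap f g (coprod << isoclass G >>)) =
  \sum_(I : {set T})
    f << isoclass (induced G I) >> * g << isoclass (induced G (~: I)) >>.
Proof.
rewrite coprodE /coprod_graph (linear_sum (tensmap f g)) (linear_sum mult).
by apply: eq_bigr => I _; rewrite /= /tensmap linextU mult_tens.
Qed.
End Hopf.

Arguments mult {K} _.
Arguments coprod {K} _.
Arguments counit {K} _.

Section AntipodeExists.
Variable K : fieldType.

(* Since the product and the coproduct are commutative, a left convolution
   inverse of the identity is a two-sided one. *)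
Lemma is_antipodeP (S : {linear Hgr K -> Hgr K}) :
  is_antipode S <->
  forall (T : finType) (G : sgraph T),
    \sum_(I : {set T})
      S << isoclass (induced G I) >> * << isoclass (induced G (~: I)) >> =
    (#|T| == 0%N)%:R.
Proof.
split=> [h T G|h x].
  have [+ _] := h << isoclass G >>.
  by rewrite mult_tensmap_coprod counitE scaler_nat.
have hU (c : isograph) :
    mult (tensmap S id (coprod << c >>)) = counit << c >> *: 1 /\
    mult (tensmap id S (coprod << c >>)) = counit << c >> *: 1.
  elim/isoclass_ind: c => T G; rewrite counitE scaler_nat.
  split; rewrite mult_tensmap_coprod; first exact: h.
  rewrite (reindex_inj (inv_inj (@setCK T))) -[RHS](h T G); apply: eq_bigr => I _.
  by rewrite setCK mulrC.
have counitL : counit x *: 1 = \sum_(b <- msupp x) x@_b *: (counit << b >> *: 1)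
    :> Hgr K.
  rewrite {1}/counit linextE scaler_suml; apply: eq_bigr => b _.
  by rewrite -scalerA /counit linextU.
have ext f g : mult (tensmap f g (coprod x)) =
    \sum_(b <- msupp x) x@_b *: mult (tensmap f g (coprod << b >>)).
  rewrite {1}[x]malg_basis (linear_sum coprod) (linear_sum (tensmap f g)).
  rewrite (linear_sum mult); apply: eq_bigr => b _.
  by rewrite (linearZ_LR coprod) (linearZ_LR (tensmap f g)) (linearZ_LR mult).
split; rewrite counitL ext; apply: eq_bigr => b _; have [hl hr] := hU b.
  by rewrite hl; exact: erefl.
by rewrite hr; exact: erefl.
Qed.

Lemma tag_repr_isoclass (T : finType) (G : sgraph T) :
  tag (repr (isoclass G)) = #|T|.
Proof.
have /isoclassP[f /bij_eq_card] := reprgK (isoclass G).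
by rewrite card_ord.
Qed.

Fixpoint antipode_rec (n : nat) (c : isograph) : Hgr K :=
  if c == isoone then 1 else
  if n is n'.+1 then
    - \sum_(I | I != [set: 'I_(tag (repr c))])
        antipode_rec n' (isoclass (induced (reprg c) I)) *
        << isoclass (induced (reprg c) (~: I)) >>
  else 0.

Definition antipode_fun : Hgr K -> Hgr K :=
  linext (fun c : isograph => antipode_rec (tag (repr c)) c).

HB.instance Definition _ := GRing.Linear.copy antipode_fun (linext _).

Lemma isoone_tag c : (c == isoone) = (tag (repr c) == 0)%N.
Proof. by rewrite -[in LHS](reprgK c) isoclass_eq1 card_ord. Qed.

Lemma tag_induced c (I : {set 'I_(tag (repr c))}) : I != setT ->
  (tag (repr (isoclass (induced (reprg c) I))) < tag (repr c))%N.
Proof.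
move=> IT; rewrite tag_repr_isoclass card_sig -[ltnRHS]card_ord -cardsT.
by apply: proper_card; rewrite properT.
Qed.

Lemma antipode_recS n c : c != isoone ->
  antipode_rec n.+1 c =
    - \sum_(I | I != [set: 'I_(tag (repr c))])
        antipode_rec n (isoclass (induced (reprg c) I)) *
        << isoclass (induced (reprg c) (~: I)) >>.
Proof. by rewrite /= => /negPf->. Qed.

Lemma antipode_rec1 n : antipode_rec n isoone = 1.
Proof. by case: n => [|n] /=; rewrite eqxx. Qed.

Lemma antipode_recE n m c :
  (tag (repr c) <= n)%N -> (tag (repr c) <= m)%N ->
  antipode_rec n c = antipode_rec m c.
Proof.
have [-> _ _|c1] := eqVneq c isoone; first by rewrite !antipode_rec1.
elim: n m c c1 => [|n IHn] m c c1 cn cm.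
  by move: c1; rewrite isoone_tag -leqn0 cn.
case: m cm => [|m] cm; first by move: c1; rewrite isoone_tag -leqn0 cm.
rewrite (antipode_recS n c1) (antipode_recS m c1).
apply: congr1; apply: eq_bigr => I IT; apply: (congr1 (fun u => u * _)).
have [->|d1] := eqVneq (isoclass (induced (reprg c) I)) isoone.
  by rewrite !antipode_rec1.
by apply: IHn; rewrite // -ltnS (leq_trans (tag_induced IT)).
Qed.

Lemma antipode_funE (c : isograph) n : (tag (repr c) <= n)%N ->
  antipode_fun << c >> = antipode_rec n c.
Proof. by move=> cn; rewrite /antipode_fun linextU; apply: antipode_recE. Qed.

Lemma Hgr1E : << isoone >> = 1 :> Hgr K.
Proof. exact: (mpolyC1E isograph K). Qed.

Lemma antipode_exists : exists S : {linear Hgr K -> Hgr K}, is_antipode S.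
Proof.
exists antipode_fun; apply/is_antipodeP.
suff h c : \sum_(I : {set 'I_(tag (repr c))})
      antipode_fun << isoclass (induced (reprg c) I) >> *
      << isoclass (induced (reprg c) (~: I)) >> = (c == isoone)%:R.
  move=> T G; have := h (isoclass G); rewrite isoclass_eq1 => <-.
  rewrite -!(mult_tensmap_coprod antipode_fun id) /=.
  by rewrite reprgK.
have indT : isoclass (induced (reprg c) setT) = c.
  rewrite -[RHS]reprgK; apply/isoclassP; apply: isomorphic_pullback.
  by exists (fun x => Sub x (in_setT x)) => x //; apply: val_inj.
have ind0 : isoclass (induced (reprg c) (~: setT)) = isoone.
  apply/eqP; rewrite isoclass_eq1 card_sig setCT.
  by apply/eqP/eq_card0 => x; rewrite inE.
have topE : antipode_fun << isoclass (induced (reprg c) setT) >> *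
    << isoclass (induced (reprg c) (~: setT)) >> =
    antipode_rec (tag (repr c)) c.
  rewrite indT ind0 Hgr1E mulr1; exact: antipode_funE.
rewrite (bigD1 setT isT).
apply: (etrans (congr1 (fun u => u + _) topE)).
rewrite /=.
have [c1|c1] := eqVneq c isoone.
  have -> : antipode_rec (tag (repr c)) c = 1 by rewrite c1 antipode_rec1.
  rewrite big1; first by rewrite addr0.
  have c0 : tag (repr c) = 0%N by apply/eqP; rewrite -isoone_tag c1.
  move=> I /tag_induced lt_c; exfalso; move: lt_c.
  by rewrite [X in (_ < X)%N]c0 ltn0.
have [n En] : exists n, tag (repr c) = n.+1.
  by move: c1; rewrite isoone_tag; case: (tag _) => // n _; exists n.
have cn : (tag (repr c) <= n.+1)%N by rewrite En.
rewrite (antipode_recE (leqnn _) cn) (antipode_recS n c1).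
rewrite [X in _ + X](_ : _ = \sum_(I | I != [set: 'I_(tag (repr c))])
    antipode_rec n (isoclass (induced (reprg c) I)) *
    << isoclass (induced (reprg c) (~: I)) >>); first by rewrite addNr.
apply: eq_bigr => I IT; rewrite (@antipode_funE _ n); first exact: erefl.
by rewrite -ltnS -En tag_induced.
Qed.

End AntipodeExists.

Definition mgraph_pred (T : finType) (EA : {set {set T}} * {set T * T}) : bool :=
  [&& [forall e in EA.1, #|e| == 2],
      [forall a in EA.2, a.1 != a.2] &
      [forall x, forall y, (x != y) ==>
        (([set x; y] \in EA.1) + ((x, y) \in EA.2) + ((y, x) \in EA.2) <= 1)]]%N.

Record mgraph (T : finType) := MGraph {
  mgraph_val : {set {set T}} * {set T * T};
  mgraph_valP : mgraph_pred mgraph_val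
}.

HB.instance Definition _ (T : finType) := [isSub for @mgraph_val T].
HB.instance Definition _ (T : finType) := [Finite of mgraph T by <:].

Definition medges (T : finType) (H : mgraph T) : {set {set T}} :=
  (mgraph_val H).1.
Definition arcs (T : finType) (H : mgraph T) : {set T * T} := (mgraph_val H).2.

Section MixedGraph.
Variables (T : finType) (H : mgraph T).

Fact gr0_axiom : [forall e in medges H, #|e| == 2].
Proof. by have /and3P[] := mgraph_valP H. Qed.

Definition gr0 : sgraph T := SGraph gr0_axiom.

Definition gr_edges : {set {set T}} :=
  medges H :|: [set [set a.1; a.2] | a in arcs H].

Fact gr_axiom : [forall e in gr_edges, #|e| == 2].
Proof.
have /and3P[/forall_inP Ecard /forall_inP Aneq _] := mgraph_valP H.
apply/forall_inP => e; rewrite inE => /orP[/Ecard //|/imsetP[a /Aneq an ->]].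
by rewrite cards2 an.
Qed.

Definition gr : sgraph T := SGraph gr_axiom.

Definition mstep (x y : T) : Prop :=
  [set x; y] \in medges H \/ (x, y) \in arcs H.

(* The sequence x_0, ..., x_n consists of the first n.+1 values of x. *)
Definition not_totally_acyclic : Prop :=
  exists (n : nat) (x : nat -> T),
    [/\ (2 <= n)%N, x 0%N = x n,
        forall i, (i < n)%N -> mstep (x i) (x i.+1) &
        exists2 i, (i < n)%N & (x i, x i.+1) \in arcs H].

Definition totally_acyclic : Prop := ~ not_totally_acyclic.

Definition mstepb : rel T :=
  fun x y => ([set x; y] \in medges H) || ((x, y) \in arcs H).

Lemma not_totally_acyclicP :
  reflect not_totally_acyclic
    [exists a in arcs H, connect mstepb a.2 a.1].
Proof.
have stepP x y : mstepb x y <-> mstep x y.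
  by split=> [/orP|h]; last exact/orP.
have /and3P[_ /forall_inP Aneq _] := mgraph_valP H.
apply: (iffP exists_inP) => [[[u v] /= uvA /connectP[p pP pu]]|].
  have p0 : (0 < size p)%N.
    by case: p pP pu => //= _ uv; have := Aneq _ uvA; rewrite uv eqxx.
  exists (size p).+1, (nth u (u :: v :: p)); split=> //=.
  - by rewrite {1}pu -nth_last; case: (p) p0 => //= w q _; exact: set_nth_default.
  - case=> [|i] ip /=; first by right.
    by apply/stepP; have /pathP/(_ i ip) := pP.
  - by exists 0%N.
move=> [n [x [n2 x0n xstep [i i_n iA]]]]; exists (x i, x i.+1) => //=.
have conn j k : (j + k <= n)%N -> connect mstepb (x j) (x (j + k)%N).
  elim: k => [|k IHk]; first by rewrite addn0 connect0.
  rewrite addnS => jk; apply: connect_trans (IHk (ltnW jk)) (connect1 _).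
  exact/stepP/xstep.
apply: (@connect_trans _ _ (x n)).
  by have := conn i.+1 (n - i.+1)%N; rewrite subnKC //; apply.
by rewrite -x0n; apply: (conn 0%N i); exact: ltnW.
Qed.

Lemma totally_acyclic_dec : {totally_acyclic} + {~ totally_acyclic}.
Proof.
by case: not_totally_acyclicP => h; [right => /(_ h) | left].
Defined.

End MixedGraph.

Definition PO_tac (T : finType) (G : sgraph T) : {set mgraph T} :=
  [set H | (gr H == G) && totally_acyclic_dec H].

Lemma PO_tacP (T : finType) (G : sgraph T) (H : mgraph T) :
  reflect (gr H = G /\ totally_acyclic H) (H \in PO_tac G).
Proof.
rewrite inE; apply: (iffP andP) => -[/eqP HG]; case: totally_acyclic_dec => //=.
Qed.

(* Main.v *)
Require Import Defs.
From HB Require Import structures.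
From mathcomp Require Import all_boot all_algebra.
From mathcomp.multinomials Require Import monalg.

Set Implicit Arguments.
Unset Strict Implicit.
Unset Printing Implicit Defensive.

Import GRing.Theory.
Local Open Scope ring_scope.

(** The antipode [S] is a left convolution inverse of the identity:
the sum over the subsets [I] of the vertex set of [S (G|I) * G|~I] vanishes
unless [G] is empty.  This determines [S G] by induction on the number of
vertices, so it suffices that the announced sum over totally acyclic partial
orientations satisfies the same identity ([sum_tac_sum_induced]).

A partial orientation of a given [G] is the same thing as its set of arcs, so
one sums over sets [A] of arcs ([sum_PO_tac]).  Let [H] be a totally acyclic
partial orientation of [G|I].  Leave the edges of [G|~I] unoriented, and orient
the edges between [I] and its complement towards the complement: the result is
a totally acyclic partial orientation of [G] for which [~I] is a sink set, that
is, no arc starts in [~I] and every edge of [G] leaving [~I] is oriented into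
[~I].  This is a bijection from the totally acyclic partial orientations of
[G|I] onto the totally acyclic partial orientations of [G] for which [~I] is a
sink set ([acyclic_glue_arcs]).  It turns the product of [gr0 H] and [G|~I]
into the unoriented part of the new orientation ([isoclass_restrict]), and
[cc (gr0 H)] into the number of components of that graph lying inside [I]
([cc_restrict]).

It remains to fix a totally acyclic partial orientation of [G] and to show that the
signs, summed over all [I] whose complement is a sink set, cancel when [G] has
a vertex ([sum_sink_sets]).  The vertices reachable from a vertex with the
fewest reachable vertices form a single component of the unoriented part, and
this component is a sink set ([exists_sink_component]).  Moving it into or out
of [I] preserves the sink sets and changes the sign. *)

(** * Partial orientations as sets of arcs *)

Section Arcs.
Variables (T : finType) (G : sgraph T).
Implicit Types (A : {set T * T}) (x y : T).

(** One step of a directed walk when the edges of [G] are oriented by the arcs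
in [A]: an arc, or an edge of [G] oriented neither way. *)
Definition arc_step A : rel T :=
  fun x y => adj G x y && (((x, y) \in A) || ((y, x) \notin A)).

(** The set [A] of arcs, all of them along edges of [G], gives a totally acyclic
partial orientation.  Antisymmetry of [A] follows, as in
[acyclic_arcs_asym]. *)
Definition acyclic_arcs A : bool :=
  [forall a in A, adj G a.1 a.2 && ~~ connect (arc_step A) a.2 a.1].

Fact unoriented_axiom A :
  [forall e in [set e in edges G | [forall a in A, [set a.1; a.2] != e]],
    #|e| == 2].
Proof. by apply/forall_inP => e; rewrite inE => /andP[/card_edge ->]. Qed.

(** The subgraph of [G] formed by the edges not oriented by [A]. *)
Definition unoriented A : sgraph T := SGraph (unoriented_axiom A).

Lemma eq_set2 (x y z t : T) : [set x; y] = [set z; t] ->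
  (x = z /\ y = t) \/ (x = t /\ y = z).
Proof.
move=> e.
have : x \in [set z; t] by rewrite -e set21.
have : y \in [set z; t] by rewrite -e set22.
have : z \in [set x; y] by rewrite e set21.
have : t \in [set x; y] by rewrite e set22.
rewrite !inE; do 4![case/orP=> /eqP ?]; subst; by [left|right].
Qed.

Lemma not_underlying_arcE A x y :
  [forall a in A, [set a.1; a.2] != [set x; y]] =
  ((x, y) \notin A) && ((y, x) \notin A).
Proof.
apply/forall_inP/andP => [h|[xy yx] [u v] uvA /=].
  split; apply/negP => /h; first by rewrite eqxx.
  by rewrite /= setUC eqxx.
apply/eqP => /eq_set2[] [ux vy]; subst; first by rewrite uvA in xy.
by rewrite uvA in yx.
Qed.

Lemma adj_unoriented A x y : adj (unoriented A) x y =
  [&& adj G x y, (x, y) \notin A & (y, x) \notin A].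
Proof. by rewrite /adj inE not_underlying_arcE. Qed.

Lemma acyclic_arcs_adj A x y : acyclic_arcs A -> (x, y) \in A -> adj G x y.
Proof. by move=> /forall_inP h /h /andP[]. Qed.

Lemma acyclic_arcs_noreturn A x y : acyclic_arcs A -> (x, y) \in A ->
  ~~ connect (arc_step A) y x.
Proof. by move=> /forall_inP h /h /andP[]. Qed.

Lemma acyclic_arcs_asym A x y : acyclic_arcs A -> (x, y) \in A ->
  (y, x) \notin A.
Proof.
move=> hA xyA; apply/negP => yxA.
have /negP := acyclic_arcs_noreturn hA xyA; apply; apply: connect1.
by rewrite /arc_step (acyclic_arcs_adj hA yxA) yxA.
Qed.

Fact mgraph_of_arcs_axiom A :
  mgraph_pred (edges (unoriented A),
    [set a in A | adj G a.1 a.2 && ((a.2, a.1) \notin A)]).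
Proof.
apply/and3P; split => /=.
- exact: (edges_axiom (unoriented A)).
- by apply/forall_inP => -[x y]; rewrite inE => /and3P[_ /adj_neq].
apply/forallP => x; apply/forallP => y; apply/implyP => _.
rewrite !inE not_underlying_arcE /=.
by case: (_ \in edges _); case: (adj _ _ _); case: (adj _ _ _);
  case: ((x, y) \in A); case: ((y, x) \in A).
Qed.

(** The partial orientation of [G] with set of arcs [A].  Arcs of [A] that are
not along edges of [G], or whose opposite is also in [A], are dropped, so that
it is a mixed graph for every [A]; none is dropped if [acyclic_arcs A]. *)
Definition mgraph_of_arcs A : mgraph T := MGraph (mgraph_of_arcs_axiom A).

Lemma arcs_mgraph_of_arcs A :
  acyclic_arcs A -> arcs (mgraph_of_arcs A) = A.
Proof.
move=> hA; apply/setP => -[x y]; rewrite inE /=.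
case xyA: (_ \in A) => //=.
by rewrite (acyclic_arcs_adj hA xyA) (acyclic_arcs_asym hA xyA).
Qed.

Lemma gr_mgraph_of_arcs A : acyclic_arcs A -> gr (mgraph_of_arcs A) = G.
Proof.
move=> hA; apply: val_inj; apply/setP => e; rewrite /= /gr_edges.
rewrite (arcs_mgraph_of_arcs hA) /medges /= !inE.
apply/orP/idP => [[/andP[] //|/imsetP[[x y] xyA ->]]|eG].
  exact: (acyclic_arcs_adj hA xyA).
case/boolP: [forall a in A, [set a.1; a.2] != e] => h; [left|right].
  by rewrite eG.
move: h; rewrite negb_forall_in => /exists_inP[a aA /negPn/eqP <-].
exact: imset_f.
Qed.

Lemma medges_card (H : mgraph T) e : e \in medges H -> #|e| = 2.
Proof.
by case/and3P: (mgraph_valP H) => /forall_inP h _ _ /h /eqP.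
Qed.

Lemma medges_arcs (H : mgraph T) x y :
  [set x; y] \in medges H -> (x, y) \notin arcs H.
Proof.
move=> xyE; have := medges_card xyE; rewrite cards2.
have [//|xy _] := eqVneq x y.
have /and3P[_ _ /forallP/(_ x)/forallP/(_ y)] := mgraph_valP H.
rewrite xy /= -/(medges H) -/(arcs H) xyE.
by case: (_ \in _).
Qed.

Lemma adj_gr (H : mgraph T) x y : adj (gr H) x y =
  [|| [set x; y] \in medges H, (x, y) \in arcs H | (y, x) \in arcs H].
Proof.
rewrite /adj inE; apply: congr2 => //.
apply/imsetP/orP => [[[u v] uvA /eq_set2[] [-> ->]]|[h|h]]; rewrite ?uvA; auto.
  by exists (x, y).
by exists (y, x); rewrite //= setUC.
Qed.
End Arcs.

Lemma unoriented_arcs (T : finType) (H : mgraph T) :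
  unoriented (gr H) (arcs H) = gr0 H.
Proof.
apply: val_inj; apply/setP => e /=; rewrite !inE.
apply/andP/idP => [[/orP[//|/imsetP[a aA ->] /forall_inP/(_ _ aA)/eqP //]]|eH].
rewrite eH; split=> //; apply/forall_inP => -[x y] aA /=.
by apply: contraL aA => /eqP xye; apply: medges_arcs; rewrite xye.
Qed.

Lemma mstepb_arc_step (T : finType) (H : mgraph T) :
  mstepb H =2 arc_step (gr H) (arcs H).
Proof.
move=> x y; rewrite /mstepb /arc_step adj_gr.
case xyE: (_ \in medges H).
  by rewrite /= orbC (@medges_arcs _ H y x) // setUC.
by case: (_ \in _) => //=; case: (_ \in _).
Qed.

(** The totally acyclic partial orientations of [G] are the images under
[mgraph_of_arcs] of the sets satisfying [acyclic_arcs], on which [arcs] is an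
inverse bijection. *)
Lemma PO_tac_acyclic_arcs (T : finType) (G : sgraph T) (H : mgraph T) :
  (H \in PO_tac G) =
  acyclic_arcs G (arcs H) && (mgraph_of_arcs G (arcs H) == H).
Proof.
have cycE : gr H = G -> [exists a in arcs H, connect (mstepb H) a.2 a.1] =
    [exists a in arcs H, connect (arc_step G (arcs H)) a.2 a.1].
  move=> <-; apply: eq_existsb => a; congr (_ && _).
  by apply: eq_connect; exact: mstepb_arc_step.
apply/PO_tacP/andP => [[HG tac]|[acyc /eqP HE]].
  have acyc : acyclic_arcs G (arcs H).
    apply/forall_inP => -[x y] xyA /=; apply/andP; split.
      by rewrite -HG adj_gr xyA orbT.
    apply/negP => yx; apply: tac; apply/not_totally_acyclicP.
    by rewrite cycE //; apply/exists_inP; exists (x, y).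
  split=> //; apply/eqP/val_inj; rewrite /= [RHS]surjective_pairing.
  congr pair; last exact: (arcs_mgraph_of_arcs acyc).
  by move: (congr1 val (unoriented_arcs H)); rewrite HG.
have HG : gr H = G by rewrite -HE gr_mgraph_of_arcs.
split=> // /not_totally_acyclicP; rewrite cycE // => /exists_inP[a aA].
by apply/negP; case/andP: (forall_inP acyc _ aA).
Qed.

Lemma sum_PO_tac (V : nmodType) (T : finType) (G : sgraph T)
    (F : sgraph T -> V) :
  \sum_(H in PO_tac G) F (gr0 H) =
  \sum_(A | acyclic_arcs G A) F (unoriented G A).
Proof.
rewrite [RHS](reindex_onto (@arcs T) (mgraph_of_arcs G)); last first.
  by move=> A; exact: arcs_mgraph_of_arcs.
apply: eq_big => [H|H /PO_tacP[HG _]]; first exact: PO_tac_acyclic_arcs.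
by rewrite -HG unoriented_arcs.
Qed.

(** * Sink sets and cancellation of signs *)

Section SinkSets.
Variables (T : finType) (G : sgraph T).
Implicit Types (A : {set T * T}) (I J : {set T}) (x y : T).

(** [J] is a sink set of the orientation by [A]: no arc starts in [J], and every
edge of [G] with exactly one end in [J] is oriented into [J]. *)
Definition sink_set A J : bool :=
  [forall x in J, forall y, adj G x y ==>
    ((x, y) \notin A) && ((y \in J) || ((y, x) \in A))].

Lemma sink_setP A J :
  reflect (forall x y, x \in J -> adj G x y ->
             (x, y) \notin A /\ (y \notin J -> (y, x) \in A))
          (sink_set A J).
Proof.
apply: (iffP forall_inP) => [h x y xJ xy|h x xJ].
  have /forallP/(_ y) := h x xJ; rewrite xy /= => /andP[-> /orP[->|->]] //.
apply/forallP => y; apply/implyP => xy; have [-> /=] := h x y xJ xy.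
by case: (y \in J) => //= ->.
Qed.

Lemma sink_set_step A J x y :
  sink_set A J -> arc_step G A x y -> x \in J -> y \in J.
Proof.
move=> /sink_setP h /andP[xy st] xJ; have [xyA yxA] := h x y xJ xy.
apply/negPn/negP => /yxA {}yxA; move: st.
by rewrite (negPf xyA) yxA.
Qed.

Lemma sink_set_reach A J x y :
  sink_set A J -> connect (arc_step G A) x y -> x \in J -> y \in J.
Proof.
move=> hJ /connectP[p + ->]; elim: p x => //= z p IHp x /andP[xz zp] xJ.
exact: IHp zp (sink_set_step hJ xz xJ).
Qed.

Lemma unoriented_step A x y : adj (unoriented G A) x y -> arc_step G A x y.
Proof. by rewrite adj_unoriented /arc_step => /and3P[-> _ ->]; rewrite orbT. Qed.

Lemma unoriented_sym A : connect_sym (adj (unoriented G A)).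
Proof.
by apply: sym_connect_sym; exact: adj_sym.
Qed.

Lemma closed_sink_set A J : sink_set A J -> closed (adj (unoriented G A)) J.
Proof.
move=> hJ; apply: intro_closed; first exact: unoriented_sym.
by move=> x y /unoriented_step; exact: sink_set_step.
Qed.

(** The vertices of the connected component of [x] in the unoriented part. *)
Definition component A x : {set T} :=
  [set y | connect (adj (unoriented G A)) x y].

Lemma exists_sink_component A (x0 : T) : acyclic_arcs G A ->
  exists x, sink_set A (component A x).
Proof.
move=> hA.
have [x _ xmin] := @arg_minnP _ x0 predT
  (fun z => #|[set y | connect (arc_step G A) z y]|) isT.
(* A vertex reachable from [x] reaches no fewer vertices than [x], hence exactly
   the same ones, [x] among them. *)
have back y : connect (arc_step G A) x y -> connect (arc_step G A) y x.
  move=> xy; have sub : [set z | connect (arc_step G A) y z] \subset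
      [set z | connect (arc_step G A) x z].
    by apply/subsetP => z; rewrite !inE; exact: connect_trans.
  have /eqP/setP/(_ x) := (etrans (eqEcard _ _) (introT andP (conj sub (xmin y isT)))).
  by rewrite !inE connect0.
(* An arc starting at a vertex reachable from [x] would thus lie on a cycle. *)
have noarc y z : connect (arc_step G A) x y -> (y, z) \notin A.
  move=> xy; apply/negP => yzA.
  have /negP := acyclic_arcs_noreturn hA yzA; apply.
  apply: (connect_trans _ xy); apply: back; apply: connect_trans xy (connect1 _).
  by rewrite /arc_step (acyclic_arcs_adj hA yzA) yzA.
(* So no step of a walk from [x] follows an arc, and reachability from [x] is
   connectedness in the unoriented part. *)
have compE : component A x = [set y | connect (arc_step G A) x y].
  apply/setP => y; rewrite !inE; apply/idP/idP; last first.
    move=> /connectP[p xp ->].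
    have reach w : connect (arc_step G A) x w -> path (arc_step G A) w p ->
        connect (adj (unoriented G A)) w (last w p); last exact: reach.
    elim: p {xp} w => //= z p IHp w xw /andP[wz zp].
    have xz := connect_trans xw (connect1 wz).
    apply: connect_trans (connect1 _) (IHp z xz zp).
    by rewrite adj_unoriented !noarc // !andbT; case/andP: wz.
  have sub : subrel (adj (unoriented G A)) (connect (arc_step G A)).
    by move=> u v /unoriented_step /connect1.
  exact: (connect_sub sub).
exists x; rewrite compE.
apply/sink_setP => y z; rewrite !inE => xy yz; split; first exact: noarc.
apply: contraNT => zyA; apply: connect_trans xy (connect1 _).
by rewrite /arc_step yz zyA orbT.
Qed.

(** The symmetric difference of [I] and [J]. *)
Definition symdiff I J := (I :\: J) :|: (J :\: I).

Lemma symdiffK J : involutive (symdiff^~ J).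
Proof. by move=> I; apply/setP => x; rewrite !inE; do 2!case: (_ \in _). Qed.

(** A sink set is a union of components, so it contains the component of [x]
or is disjoint from it. *)
Lemma sink_set_symdiff A J x :
  sink_set A (component A x) -> sink_set A J ->
  sink_set A (symdiff J (component A x)).
Proof.
set C := component A x => hC hJ.
have allC y z : y \in C -> y \in J -> z \in C -> z \in J.
  rewrite !inE => xy yJ xz.
  have cl := closed_connect (closed_sink_set hJ).
  by rewrite -(cl _ _ xz) (cl _ _ xy).
move/sink_setP: (hC) => sC; move/sink_setP: (hJ) => sJ.
apply/sink_setP => y z; rewrite ![_ \in symdiff _ _]inE ![_ \in _ :\: _]inE.
case/orP=> /andP[yN yin] yz.
  have [yzA zyA] := sJ y z yin yz; split=> // zN; apply: zyA.
  apply: contra zN => zJ; rewrite zJ andbT orbF; apply: contra yzA => zC.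
  by have [|_ ->] := sC z y zC; rewrite // adj_sym.
have [yzA zyA] := sC y z yin yz; split=> // zN; apply: zyA.
apply: contra zN => zC; rewrite zC andbT /=; apply: contra yN => zJ.
exact: allC zJ yin.
Qed.

Lemma n_comp_component A I x : I :&: component A x = set0 ->
  n_comp (adj (unoriented G A)) (I :|: component A x) =
  (n_comp (adj (unoriented G A)) I).+1.
Proof.
move=> /setP I0; rewrite -add1n -(n_comp_connect (unoriented_sym A) x).
rewrite /n_comp_mem -(cardID (component A x)); congr (_ + _)%N.
  apply: eq_card => y; rewrite !inE.
  by case: (connect _ x y); rewrite ?orbT ?andbT ?andbF.
apply: eq_card => y; have := I0 y; rewrite !inE.
by case: (y \in I); case: (connect _ x y); rewrite ?andbF ?andbT.
Qed.

(** Each sink set is paired with its symmetric difference with one fixed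
component that is itself a sink set. *)
Lemma sum_sink_sets (K : pzRingType) A :
  acyclic_arcs G A ->
  \sum_(I : {set T} | sink_set A (~: I))
     (-1) ^+ n_comp (adj (unoriented G A)) I = (#|T| == 0)%N%:R :> K.
Proof.
move=> hA.
have [T0|/card_gt0P[x0 _]] := posnP #|T|.
  have e0 (I : {set T}) : I = set0.
    by apply/setP => y; have := fintype0 y T0.
  rewrite (big_pred1 set0) => [|I]; last first.
    rewrite /= (e0 I) eqxx; apply/sink_setP => x; by have := fintype0 x T0.
  by rewrite /n_comp_mem eq_card0 // => x; have := fintype0 x T0.
have [x hx] := exists_sink_component x0 hA.
set C := component A x in hx.
have symdiffC I : ~: symdiff I C = symdiff (~: I) C.
  by apply/setP => y; rewrite !inE; case: (y \in I); case: (connect _ x y).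
have sinkE I : sink_set A (~: symdiff I C) = sink_set A (~: I).
  rewrite symdiffC; apply/idP/idP => h; last exact: sink_set_symdiff.
  by rewrite -[~: I](symdiffK C); apply: sink_set_symdiff.
(* The terms with [x] in [I] are reindexed by [symdiff], and become the opposites
   of the terms with [x] outside [I]. *)
rewrite (bigID (fun I : {set T} => x \in I)) /=.
rewrite (reindex_inj (inv_inj (symdiffK C))) /=.
rewrite -[RHS](addNr (\sum_(I | sink_set A (~: I) && (x \notin I))
     (-1) ^+ n_comp (adj (unoriented G A)) I)).
congr (_ + _); rewrite -sumrN; apply: eq_big => I.
  by rewrite sinkE !inE connect0; case: (x \in I).
case/andP; rewrite sinkE => hI; rewrite !inE connect0 /= andbT => xI.
have cl := closed_connect (closed_sink_set hI).
have IC : I :&: C = set0.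
  apply/setP => y; rewrite !inE; apply/negP => /andP[yI xy].
  by have := cl _ _ xy; rewrite !inE yI xI.
have -> : symdiff I C = I :|: C.
  apply/setP => y; have /setP/(_ y) := IC; rewrite !inE.
  by case: (y \in I); case: (connect _ x y).
by rewrite n_comp_component // exprS mulN1r.
Qed.
End SinkSets.

(** * Gluing an orientation of an induced subgraph with its complement *)

(** A walk ending in [P] stays in [P] if no step enters [P] from outside. *)
Lemma connect_relpre_val (T : finType) (P : pred T) (e : rel T)
    (x y : {z | P z}) :
  (forall u v, e u v -> P v -> P u) ->
  connect (relpre val e) x y = connect e (val x) (val y).
Proof.
move=> clP; apply/connectP/connectP => [[p xp ->]|[p]].
  by exists (map val p); rewrite ?last_map // path_map.
elim: p x => [|z p IHp] x /=; first by move=> _ /val_inj ->; exists [::].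
move=> /andP[xz zp] yE.
have Pz : P z.
  have : P (last z p) by rewrite -yE; exact: (valP y).
  elim: p z zp {IHp xz yE} => //= w p IHp z.
  by case/andP=> zw wp /(IHp _ wp); exact: clP zw.
have [q qp yq] := IHp (Sub z Pz) zp yE.
by exists (Sub z Pz :: q); rewrite //= xz.
Qed.

Section Glue.
Variables (T : finType) (G : sgraph T) (I : {set T}).
Local Notation sT := {x : T | x \in I}.
Implicit Types (A : {set T * T}) (B : {set sT * sT}).

(** The arcs of [A] between vertices of [I], as arcs of [induced G I]. *)
Definition restrict_arcs A : {set sT * sT} :=
  [set a | (val a.1, val a.2) \in A].

(** The arcs [B] of [induced G I], together with all the edges of [G] between
[I] and its complement, oriented towards the complement. *)
Definition glue_arcs B : {set T * T} :=
  [set (val a.1, val a.2) | a in B] :|: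
  [set a | [&& a.1 \in I, a.2 \notin I & adj G a.1 a.2]].

Lemma adj_induced (x y : sT) : adj (induced G I) x y = adj G (val x) (val y).
Proof. by rewrite /adj inE imsetU1 imset_set1. Qed.

Lemma mem_glue_arcs_val B (x y : sT) :
  ((val x, val y) \in glue_arcs B) = ((x, y) \in B).
Proof.
rewrite !inE (valP y) andbF orbF.
apply/imsetP/idP => [[[u v] uvB [] /val_inj -> /val_inj -> //]|xyB].
by exists (x, y).
Qed.

Lemma mem_glue_arcs_out B x y : x \notin I -> (x, y) \notin glue_arcs B.
Proof.
move=> xI; rewrite !inE (negPf xI) orbF; apply/imsetP => -[[u v] _ [xu _]].
by rewrite xu (valP u) in xI.
Qed.

Lemma mem_glue_arcs_into B x y : x \in I -> y \notin I ->
  ((x, y) \in glue_arcs B) = adj G x y.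
Proof.
move=> xI yI; rewrite !inE xI yI /=.
case: imsetP => [[[u v] _ [_ yv]]|_] //=.
by rewrite yv (valP v) in yI.
Qed.

Lemma glue_arcsK : cancel glue_arcs restrict_arcs.
Proof. by move=> B; apply/setP => -[x y]; rewrite inE mem_glue_arcs_val. Qed.

Lemma arc_step_restrict A (x y : sT) :
  arc_step (induced G I) (restrict_arcs A) x y = arc_step G A (val x) (val y).
Proof. by rewrite /arc_step adj_induced !inE. Qed.

Lemma adj_unoriented_restrict A (x y : sT) :
  adj (unoriented (induced G I) (restrict_arcs A)) x y =
  adj (unoriented G A) (val x) (val y).
Proof. by rewrite !adj_unoriented adj_induced !inE. Qed.

Lemma glue_arcs_sink_set B : sink_set G (glue_arcs B) (~: I).
Proof.
apply/sink_setP => x y; rewrite !in_setC negbK => xI xy.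
by rewrite mem_glue_arcs_out //; split=> // yI; rewrite mem_glue_arcs_into // adj_sym.
Qed.

Lemma connect_restrict A (x y : sT) : sink_set G A (~: I) ->
  connect (arc_step (induced G I) (restrict_arcs A)) x y =
  connect (arc_step G A) (val x) (val y).
Proof.
move=> hA; rewrite -connect_relpre_val => [|u v uv].
  by apply: eq_connect => u v; exact: arc_step_restrict.
by apply: contraLR; rewrite -!in_setC; exact: sink_set_step hA uv.
Qed.

(** [glue_arcs] and [restrict_arcs] are inverse bijections between the totally
acyclic partial orientations of [induced G I] and those of [G] for which [~: I] is a
sink set. *)
Lemma acyclic_glue_arcs A :
  acyclic_arcs (induced G I) (restrict_arcs A) &&
    (glue_arcs (restrict_arcs A) == A) =
  acyclic_arcs G A && sink_set G A (~: I).
Proof.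
apply/andP/andP => [[acyc /eqP AE]|[acyc hA]].
  have hA : sink_set G A (~: I) by rewrite -AE glue_arcs_sink_set.
  split=> //; apply/forall_inP => -[x y] xyA /=.
  have xI : x \in I by apply: contraLR xyA; rewrite -AE; exact: mem_glue_arcs_out.
  have [yI|yI] := boolP (y \in I).
    pose u : sT := Sub x xI; pose v : sT := Sub y yI.
    have uv : (u, v) \in restrict_arcs A by rewrite inE.
    have := acyclic_arcs_adj acyc uv; rewrite adj_induced => -> /=.
    by have := acyclic_arcs_noreturn acyc uv; rewrite connect_restrict.
  have -> /= : adj G x y.
    by rewrite -(mem_glue_arcs_into (restrict_arcs A)) // AE.
  apply/negP => /(sink_set_reach hA); rewrite !in_setC xI yI.
  by move=> /(_ isT).
split.
  apply/forall_inP => -[x y]; rewrite inE /= => xyA.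
  rewrite adj_induced (acyclic_arcs_adj acyc xyA) connect_restrict //.
  exact: acyclic_arcs_noreturn acyc xyA.
apply/eqP/setP => -[x y]; move/sink_setP: hA => hA.
have [xI|xI] := boolP (x \in I); last first.
  rewrite (negPf (mem_glue_arcs_out _ _ xI)); apply/esym/negP => xyA.
  have := hA x y; rewrite in_setC => /(_ xI (acyclic_arcs_adj acyc xyA))[].
  by rewrite xyA.
have [yI|yI] := boolP (y \in I).
  by rewrite (mem_glue_arcs_val _ (Sub x xI) (Sub y yI)) inE.
rewrite mem_glue_arcs_into //; apply/idP/idP => [xy|]; last exact: acyclic_arcs_adj.
have := hA y x; rewrite !in_setC adj_sym negbK => /(_ yI xy)[_]; exact.
Qed.

Lemma cc_restrict A : sink_set G A (~: I) ->
  cc (unoriented (induced G I) (restrict_arcs A)) =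
  n_comp (adj (unoriented G A)) I.
Proof.
move=> hA.
have clI : closed (adj (unoriented G A)) I.
  move=> x y xy; apply: negb_inj; rewrite -!in_setC.
  exact: closed_sink_set hA _ _ xy.
rewrite (adjunction_n_comp val (unoriented_sym G A)
  (unoriented_sym (induced G I) (restrict_arcs A)) clI).
  by rewrite /cc; apply: eq_n_comp_r => x; rewrite !inE (valP x).
apply: strict_adjunction => //.
- exact: unoriented_sym.
- exact: val_inj.
- by apply/subsetP => x xI; apply/codomP; exists (Sub x xI).
- by move=> x y _; rewrite adj_unoriented_restrict.
Qed.

Lemma isoclass_restrict A : sink_set G A (~: I) ->
  isomul (isoclass (unoriented (induced G I) (restrict_arcs A)))
         (isoclass (induced G (~: I))) =
  isoclass (unoriented G A).
Proof.
move=> hA; rewrite isoclass_dunion; apply/isoclassP/isomorphic_adjP.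
pose f (u : sT + {x | x \in ~: I}) := match u with inl x => val x | inr x => val x end.
exists f.
  apply: inj_card_bij; last by rewrite card_sum !card_sig -(cardsC I).
  move=> [x|x] [y|y] /= xy.
  - by congr inl; apply: val_inj.
  - by have : val x \in ~: I; [rewrite [val x]xy (valP y) | rewrite in_setC (valP x)].
  - by have : val y \in ~: I; [rewrite -[val y]xy (valP x) | rewrite in_setC (valP y)].
  - by congr inr; apply: val_inj.
move/sink_setP: hA => hA.
have cross (x : sT) (y : {x | x \in ~: I}) :
    adj (unoriented G A) (val x) (val y) = false.
  apply/negP; rewrite adj_unoriented => /and3P[xy xyA _].
  have [_] := hA _ _ (valP y) (etrans (adj_sym _ _ _) xy).
  by rewrite in_setC negbK (negPf xyA) => /(_ (valP x)).
move=> [x|x] [y|y]; rewrite adj_dunion /=.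
- by rewrite adj_unoriented_restrict.
- exact: cross.
- by rewrite adj_sym cross.
- rewrite adj_unoriented /adj inE imsetU1 imset_set1 -/(adj _ _ _).
  case xy: (adj _ _ _) => //=.
  have [-> _] := hA _ _ (valP x) xy.
  have yx : adj G (val y) (val x) by rewrite adj_sym.
  by have [-> _] := hA _ _ (valP y) yx.
Qed.
End Glue.

(** * The antipode *)

Lemma isoclass_inducedT (T : finType) (G : sgraph T) :
  isoclass (induced G setT) = isoclass G.
Proof.
apply/isoclassP; apply: isomorphic_pullback.
by exists (fun x => Sub x (in_setT x)) => x //; apply: val_inj.
Qed.

Lemma isoclass_inducedCT (T : finType) (G : sgraph T) :
  isoclass (induced G (~: setT)) = isoone.
Proof.
apply/eqP; rewrite isoclass_eq1 card_sig setCT.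
by apply/eqP/eq_card0 => x; rewrite inE.
Qed.

(** Two equal sums that agree termwise except at [i] also agree at [i]. *)
Lemma eq_sum_eq_term (V : zmodType) (J : finType) (F F' : J -> V) :
  \sum_j F j = \sum_j F' j ->
  forall i, (forall j, j != i -> F j = F' j) -> F i = F' i.
Proof.
move=> + i eqF; rewrite (bigD1 i) //= [RHS](bigD1 i) //= (eq_bigr _ eqF).
exact: addIr.
Qed.

Section Antipode.
Variable K : fieldType.

(** The right-hand side of the antipode formula, as a sum over sets of arcs. *)
Definition tac_sum (T : finType) (G : sgraph T) : Hgr K :=
  \sum_(A | acyclic_arcs G A)
    (-1) ^+ cc (unoriented G A) *: << isoclass (unoriented G A) >>.

Lemma tac_sum_mul_induced (T : finType) (G : sgraph T) (I : {set T}) :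
  tac_sum (induced G I) * << isoclass (induced G (~: I)) >> =
  \sum_(A | acyclic_arcs G A && sink_set G A (~: I))
    (-1) ^+ n_comp (adj (unoriented G A)) I *: << isoclass (unoriented G A) >>.
Proof.
rewrite /tac_sum (reindex_onto (@restrict_arcs T I) (glue_arcs G (I := I))).
  rewrite mulr_suml; apply: eq_big => [A|A]; first exact: acyclic_glue_arcs.
  rewrite acyclic_glue_arcs => /andP[_ hA].
  rewrite -scalerAl cc_restrict // malgM_def fgmulUU mulr1.
  by congr (_ *: << _ >>); exact: isoclass_restrict.
by move=> B _; exact: glue_arcsK.
Qed.

Lemma sum_tac_sum_induced (T : finType) (G : sgraph T) :
  \sum_(I : {set T})
    tac_sum (induced G I) * << isoclass (induced G (~: I)) >> =
  (#|T| == 0%N)%:R.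
Proof.
under eq_bigr do rewrite tac_sum_mul_induced.
rewrite (exchange_big_dep (acyclic_arcs G)) => [|I A _ /andP[] //] /=.
transitivity (\sum_(A | acyclic_arcs G A)
    ((#|T| == 0%N)%:R : K) *: << isoclass (unoriented G A) >> : Hgr K).
  apply: eq_bigr => A hA; rewrite -scaler_suml -(sum_sink_sets K hA).
  by congr (_ *: _); apply: eq_bigl => I; rewrite hA.
have [T0|] := posnP #|T|; last first.
  by move=> _; rewrite big1 // => A _; rewrite scale0r.
have e0 (A : {set T * T}) : A = set0.
  by apply/setP => -[y]; have := fintype0 y T0.
rewrite (big_pred1 set0) => [|A]; last first.
  rewrite /= (e0 A) eqxx; apply/forall_inP => -[x]; by have := fintype0 x T0.
rewrite scale1r.
have -> : isoclass (unoriented G set0) = isoone by apply/eqP; rewrite isoclass_eq1 T0.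
exact: Hgr1E.
Qed.

Lemma antipode_tac_sum (S : {linear Hgr K -> Hgr K}) :
  is_antipode S ->
  forall (T : finType) (G : sgraph T), S << isoclass G >> = tac_sum G.
Proof.
move=> /is_antipodeP hS T; have [n] := ubnP #|T|.
elim: n T => // n IHn T Tn G.
have := eq_sum_eq_term (etrans (hS T G) (esym (sum_tac_sum_induced G))).
move=> /(_ setT) h.
have {}h : S << isoclass (induced G setT) >> *
           << isoclass (induced G (~: setT)) >> =
           tac_sum (induced G setT) * << isoclass (induced G (~: setT)) >>.
  apply: h => I IT; congr (_ * _); apply: IHn.
  rewrite card_sig -ltnS (leq_trans _ Tn) // ltnS -cardsT.
  by apply: proper_card; rewrite properT.
move: h; rewrite tac_sum_mul_induced isoclass_inducedT isoclass_inducedCT.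
rewrite Hgr1E mulr1 => ->; apply: eq_big => [A|A _].
  suff -> : sink_set G A (~: setT) by rewrite andbT.
  by apply/sink_setP => x y; rewrite setCT inE.
by congr (_ ^+ _ *: _); apply: eq_n_comp_r => x; rewrite !inE.
Qed.
End Antipode.

Theorem proposition2p9 (K : fieldType) (K_char0 : [pchar K] =i pred0)
    (S : {linear Hgr K -> Hgr K}) (S_antipode : is_antipode S)
    (T : finType) (G : sgraph T) :
  S << isoclass G >> =
    \sum_(H in PO_tac G) (-1) ^+ cc (gr0 H) *: << isoclass (gr0 H) >>.
Proof.
rewrite (antipode_tac_sum S_antipode) /tac_sum.
by rewrite -(sum_PO_tac G (fun L => (-1) ^+ cc L *: << isoclass L >>)).
Qed.
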